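(* Let $\Delta$ be a positive integer and let $\kappa$ be a real number such that $\kappa \ge 2/\Delta^{2/3}$. If $G$ is a finite simple graph with maximum degree $\Delta$, then the acyclic chromatic number $\chi_a(G)$ satisfies \[ \chi_a(G) \le \left(\frac{1}{\kappa} + \frac{3}{2}\sqrt{\frac{3\kappa}{2}}\right)\Delta^{4/3} + \Delta - \frac{\Delta^{1/3}}{\kappa}. \] In particular, if $\Delta \ge 3$, then (taking $\kappa = \frac{2^{5/3}}{3}$) every finite simple graph $G$ with maximum degree $\Delta$ satisfies \[ \chi_a(G) \le \frac{9}{2^{5/3}}\cdot\Delta^{4/3} + \Delta < 2.83483\cdot \Delta^{4/3} + \Delta. \]
   Context: Graphs are finite and simple. An acyclic coloring of a graph $G$ is a proper vertex-coloring of $G$ (adjacent vertices receive different colors) such that for every pair of color classes, the subgraph of $G$ induced by the union of these two classes is acyclic (a forest). The acyclic chromatic number $\chi_a(G)$ is the least integer $k$ such that $G$ admits an acyclic coloring with $k$ colors. *)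

(* Defs.v *)
From mathcomp Require Import all_boot.
From mathcomp Require Import boolp.

Set Implicit Arguments.
Unset Strict Implicit.
Unset Printing Implicit Defensive.

Record sgraph := SGraph {
  vertex :> finType;
  adj : rel vertex;
  adj_sym : symmetric adj;
  adj_irrefl : irreflexive adj
}.

Definition max_degree (G : sgraph) : nat :=
  \max_(x : G) #|[set y : G | adj x y]|.

Section Induced.
Variables (G : sgraph) (A : {set G}).

Definition induced_adj : rel {x : G | x \in A} :=
  fun x y => adj (val x) (val y).

Fact induced_sym : symmetric induced_adj.
Proof. by move=> x y; apply: adj_sym. Qed.

Fact induced_irrefl : irreflexive induced_adj.
Proof. by move=> x; apply: adj_irrefl. Qed.

Definition induced : sgraph := SGraph induced_sym induced_irrefl.

End Induced.

(* The bound on the size is needed: [cycle] and [uniq] also hold of the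
   empty sequence and of [:: x; y] when x and y are adjacent. *)
Definition forest (G : sgraph) : Prop :=
  forall p : seq G, 2 < size p -> ~ (cycle (@adj G) p && uniq p).

Section Coloring.
Variables (G : sgraph) (k : nat).
Implicit Type c : G -> 'I_k.

Definition proper c : Prop := forall x y, adj x y -> c x != c y.

Definition color_class c (i : 'I_k) : {set G} := [set x | c x == i].

Definition acyclic_coloring c : Prop :=
  proper c /\
  forall i j, i != j -> forest (induced (color_class c i :|: color_class c j)).

Definition acyclic_colorable : Prop := exists c, acyclic_coloring c.

End Coloring.

Lemma acyclic_colorable_card (G : sgraph) : acyclic_colorable G #|G|.
Proof.
exists enum_rank; split=> [x y xy|i j _ p p_gt2 /andP[_ p_uniq]].
  by apply/negP => /eqP/enum_rank_inj eq_xy; rewrite eq_xy adj_irrefl in xy.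
have p_sub : {subset map val p <= [:: enum_val i; enum_val j]}.
  move=> _ /mapP[x _ ->]; move: (val x) (valP x) => y.
  by rewrite inE !in_set !inE => /orP[]/eqP <-; rewrite enum_rankK eqxx ?orbT.
have vp_uniq : uniq (map val p) by rewrite (map_inj_uniq val_inj).
by have := uniq_leq_size vp_uniq p_sub; rewrite size_map leqNgt p_gt2.
Qed.

Lemma acyclic_colorable_ex (G : sgraph) :
  exists k, `[< acyclic_colorable G k >].
Proof. by exists #|G|; apply/asboolP; exact: acyclic_colorable_card. Qed.

Definition acyclic_chromatic_number (G : sgraph) : nat :=
  ex_minn (acyclic_colorable_ex G).

(* Main.v *)
(* Write D for the maximum degree and s = kappa D^(2/3).  Two distinct vertices
   conflict when they are adjacent or have more than s common neighbors; double
   counting paths of length 2, a vertex has at most D + D(D-1)/s conflicts.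
   Count the colorings of a vertex set S in which conflicting vertices differ
   and no cycle is bicolored.  By induction on |S|, adding a vertex v multiplies
   their number by at least beta: among all extensions to v, those that create a
   bicolored cycle of length 2m+4 through v are determined by their restriction
   to S minus 2m+1 vertices of the cycle, so by induction there are at most
   N(S) / beta^(2m+1) of them.  The two neighbors on the cycle of a neighbor of
   v do not conflict, so the cycle closes up in at most s ways and there are at
   most s D (D-1)^(2m+1) / 2 such cycles.  Summing the geometric series and
   taking beta = sqrt(3 kappa / 2) D^(4/3) gives the bound. *)
Require Import Defs.
From mathcomp Require Import all_boot all_order all_algebra.
From mathcomp Require Import boolp reals exp.
From mathcomp Require Import ring lra.
Import Order.TTheory GRing.Theory Num.Theory.
Local Open Scope ring_scope.

Lemma size_allpairs_dep_le (S T U : Type) (s : seq S) (f : S -> seq T)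
    (g : S -> T -> U) b :
  (forall x, size (f x) <= b)%N ->
  (size [seq g x y | x <- s, y <- f x] <= size s * b)%N.
Proof.
move=> fb; elim: s => //= x s IH.
by rewrite size_cat size_map mulSn leq_add.
Qed.

(** * Counting walks and closed walks that start at a fixed vertex *)

Section Counting.
Local Open Scope nat_scope.
Set Implicit Arguments.
Unset Strict Implicit.
Variable G : sgraph.

Definition nbr (x : G) : {set G} := [set y | adj x y].

Variables (conf : rel G) (D L t : nat).
Hypothesis conf_sym : symmetric conf.
Hypothesis conf_irr : irreflexive conf.
Hypothesis adj_conf : forall x y : G, adj x y -> conf x y.
Hypothesis nbr_le : forall x, #|nbr x| <= D.
Hypothesis conf_le : forall x, #|[set y | conf x y]| <= L.
Hypothesis codegree_le : forall x y, x != y -> ~~ conf x y ->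
  #|nbr x :&: nbr y| <= t.

(* Walks and closed walks list their vertices backwards, with v last. *)
Definition walk_step (w : seq G) : seq G :=
  if w is x :: w' then
    if w' is y :: _ then if adj x y then enum (nbr x :\ y) else [::]
    else enum (nbr x)
  else [::].

Fixpoint walks (v : G) n : seq (seq G) :=
  if n is n'.+1 then [seq x :: w | w <- walks v n', x <- walk_step w]
  else [:: [:: v]].

(** The head of [w] and [v] are the two neighbors of the new vertex on the cycle. In a conflict-free
    bicolored cycle they share a color, so rejecting conflicting pairs loses no such cycle and
    leaves at most [t] choices. *)
Definition closing_step (v : G) (w : seq G) : seq G :=
  let x := head v w in
  if (x != v) && ~~ conf x v then enum (nbr x :&: nbr v) else [::].

Definition closed_walks v m :=
  [seq x :: w | w <- walks v m.*2.+2, x <- closing_step v w].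

Lemma walks_shape v n w : w \in walks v n -> size w = n.+1 /\ last v w = v.
Proof.
elim: n w => [|n IH] w /=; first by rewrite inE => /eqP ->.
by case/allpairsPdep => w' [x [/IH[sw lw] _ ->]] /=; case: w' sw lw => //= ? ? ->.
Qed.

(** Each step after the first excludes the vertex just left. The test [adj x y] in [walk_step]
    ensures that this vertex is a neighbor, so one choice is really lost. *)
Lemma size_walks v n : size (walks v n.+1) <= D * D.-1 ^ n.
Proof.
elim: n => [|n IH].
  by rewrite /= cats0 size_map expn0 muln1 -cardE nbr_le.
have size_w w : w \in walks v n.+1 -> 1 < size w.
  by move=> /walks_shape[->].
rewrite expnSr mulnA; apply: leq_trans (leq_mul IH (leqnn _)).
rewrite [walks v n.+2]/=; move: size_w; rewrite -/(walks v n.+1).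
elim: (walks v n.+1) => //= w s IHs sw.
rewrite size_cat size_map mulSn leq_add ?IHs //; last first.
  by move=> u us; apply: sw; rewrite inE us orbT.
have := sw w (mem_head _ _); case: w {sw} => [|x [|y w]] //= _.
case: ifP => // xy; rewrite -cardE.
have := cardsD1 y (nbr x); rewrite inE xy => Hc.
by have := nbr_le x; rewrite Hc; case: (D).
Qed.

Lemma size_closed_walks v m :
  size (closed_walks v m) <= D * D.-1 ^ m.*2.+1 * t.
Proof.
apply: leq_trans (leq_mul (size_walks v _) (leqnn t)).
apply: size_allpairs_dep_le => w; rewrite /closing_step.
by case: ifP => // /andP[xv cxv]; rewrite -cardE codegree_le.
Qed.

Lemma mem_walks v n w :
  size w = n.+1 -> last v w = v -> sorted (@adj G) w -> uniq w ->
  w \in walks v n.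
Proof.
elim: n w => [|n IH] [|x [|y w]] //=; first by move=> _ ->; rewrite inE.
move=> [sw] lw /andP[xy yw] /and3P[xyw yw' uw].
have win : y :: w \in walks v n by apply: IH => //=; rewrite ?yw' ?sw.
apply/allpairsPdep; exists (y :: w), x; split => //=.
case: w xyw {yw' uw win sw lw} yw => [|z w] /=.
  by rewrite mem_enum !inE adj_sym.
rewrite !inE !negb_or => /and3P[_ xz _] /andP[yz _].
by rewrite yz mem_enum !inE xz adj_sym.
Qed.

(** * Partial colorings and alternation along bicolored paths *)

Section Colorings.
Variables (K : nat) (o : 'I_K).
Implicit Types (c e : {ffun G -> 'I_K}) (S T : {set G}) (p q : seq G).

Definition conflict_free S c :=
  forall x y, x \in S -> y \in S -> conf x y -> c x != c y.

Definition bicolored c p :=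
  [exists i, exists j, all (fun x => c x \in [:: i; j]) p].

Definition acyclic_on S c := forall p, {subset p <= S} ->
  2 < size p -> uniq p -> cycle (@adj G) p -> ~~ bicolored c p.

(* Colorings of S are represented by total functions with the junk value o
   outside of S. *)
Definition good S := [set c : {ffun G -> 'I_K} |
  `[< [/\ forall x, x \notin S -> c x = o,
         conflict_free S c & acyclic_on S c] >]].

Definition restrict S c : {ffun G -> 'I_K} :=
  [ffun x => if x \in S then c x else o].

Definition recolor c v a : {ffun G -> 'I_K} :=
  [ffun x => if x == v then a else c x].

Lemma bicoloredP c p :
  reflect (exists i j, forall x, x \in p -> (c x == i) || (c x == j))
          (bicolored c p).
Proof.
apply: (iffP existsP) => [[i /existsP[j /allP H]]|[i [j H]]]; exists i.
  by exists j => x /H; rewrite !inE.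
by apply/existsP; exists j; apply/allP => x /H; rewrite !inE.
Qed.

Lemma eq_bicolored c e p : {in p, c =1 e} -> bicolored c p = bicolored e p.
Proof.
move=> ce; apply/bicoloredP/bicoloredP => -[i [j H]]; exists i, j => x xp.
  by rewrite -ce ?H.
by rewrite ce ?H.
Qed.

Lemma eq_mem_bicolored c p q : p =i q -> bicolored c p = bicolored c q.
Proof.
move=> pq; apply/bicoloredP/bicoloredP => -[i [j H]]; exists i, j => x xp.
  by rewrite H ?pq.
by rewrite H -?pq.
Qed.

Lemma bicolored_alternate c p x y z : bicolored c p ->
  x \in p -> y \in p -> z \in p -> c x != c y -> c y != c z -> c x = c z.
Proof.
move=> /bicoloredP[i [j H]] /H xij /H yij /H zij.
move: xij yij zij.
by case/orP => /eqP ->; case/orP => /eqP ->; case/orP => /eqP ->;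
  rewrite ?eqxx.
Qed.

Lemma good_restrict S T c : S \subset T -> c \in good T ->
  restrict S c \in good S.
Proof.
move=> /subsetP ST; rewrite !inE => /asboolP[_ cf ac]; apply/asboolP; split.
- by move=> x xS; rewrite ffunE (negPf xS).
- by move=> x y xS yS /cf H; rewrite !ffunE xS yS H ?ST.
- move=> p pS sp up cp; rewrite (@eq_bicolored _ c).
    by apply: ac => // x /pS /ST.
  by move=> x /pS xS; rewrite ffunE xS.
Qed.

Lemma good_set0 : #|good set0| = 1.
Proof.
apply/eqP/cards1P; exists [ffun => o]; apply/setP=> c; rewrite !inE.
apply/asboolP/eqP => [[H _ _]|->]; first by apply/ffunP=> x; rewrite H ?inE ?ffunE.
split=> [x _|x y|p]; rewrite ?inE ?ffunE //.
by case: p => // x p /(_ x); rewrite mem_head inE => /(_ isT).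
Qed.

Lemma good_acyclic_coloring c : c \in good setT -> acyclic_coloring c.
Proof.
rewrite inE => /asboolP[_ cf ac]; split=> [x y xy|i j ij p sp /andP[cp up]].
  by apply: cf; rewrite ?inE ?adj_conf.
have := ac (map val p); rewrite size_map (map_inj_uniq val_inj) sp up.
have -> : cycle (@adj G) (map val p) by rewrite cycle_map.
move=> H; have /bicoloredP[] := H (fun x _ => in_setT x) isT isT isT.
exists i, j => x /mapP[y _ ->].
by have := valP y; rewrite !inE.
Qed.

(** The two colors alternate, so the ends agree exactly when the number of steps is even. This is
    what makes bicolored cycles even. *)
Lemma bicolored_last c x q : bicolored c (x :: q) ->
  path (fun y z => c y != c z) x q ->
  (c (last x q) == c x) = ~~ odd (size q).
Proof.
move=> bc.
have : forall y r, {subset y :: r <= x :: q} -> path (fun y z => c y != c z) y r ->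
    (c (last y r) == c y) = ~~ odd (size r) => [y r|]; last exact.
elim: r y => [|z r IH] y yr /=; first by rewrite eqxx.
move=> /andP[yz zr]; have zr' : {subset z :: r <= x :: q}.
  by move=> u ur; apply: yr; rewrite inE ur orbT.
rewrite negbK -[odd _]negbK -(IH z) //.
have yin : y \in x :: q by apply: yr; rewrite mem_head.
have zin : z \in x :: q by apply: zr'; rewrite mem_head.
have lin : last z r \in x :: q by apply: zr'; rewrite mem_last.
have [E|E] := eqVneq (c (last z r)) (c z); first by rewrite E eq_sym (negPf yz).
by apply/eqP; rewrite (bicolored_alternate bc yin zin lin yz) // eq_sym.
Qed.

Lemma conflict_free_path T c x p : conflict_free T c ->
  {subset x :: p <= T} -> path (@adj G) x p -> path (fun y z => c y != c z) x p.
Proof.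
move=> cf; elim: p x => //= y p IH x sub /andP[xy yp]; apply/andP; split.
  by apply: cf; rewrite ?adj_conf ?sub ?inE ?eqxx ?orbT.
by apply: IH => // z zp; apply: sub; rewrite inE zp orbT.
Qed.

(** By alternation the second vertex of [q] has the color of [v], hence does not conflict with it
    and passes the test of [closing_step]. The cycle has even length [2m+4], so [q] has [2m+3]
    vertices and the index is [m]. *)
Lemma mem_closed_walks T c v q : conflict_free T c ->
  {subset rcons q v <= T} -> 1 < size q -> uniq (rcons q v) ->
  cycle (@adj G) (rcons q v) -> bicolored c (rcons q v) ->
  rcons q v \in closed_walks v (size q)./2.-1.
Proof.
case: q => [|x [|y q]] // cf sub _ up cp bp.
have pp : path (@adj G) x (rcons (y :: q) v).
  by move: cp; rewrite /= rcons_path => /and3P[-> -> _].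
have vx : adj v x.
  by move: cp; rewrite /= rcons_path last_rcons => /and3P[_ _ ->].
have xy : adj x y by case/andP: pp.
have inT z : z \in rcons (x :: y :: q) v -> z \in T by apply: sub.
have xp : x \in rcons (x :: y :: q) v by rewrite !inE eqxx.
have yp : y \in rcons (x :: y :: q) v by rewrite !inE eqxx orbT.
have vp : v \in rcons (x :: y :: q) v by rewrite mem_rcons mem_head.
have cvx : c v != c x by apply: cf; rewrite ?inT ?adj_conf.
have cxy : c x != c y by apply: cf; rewrite ?inT ?adj_conf.
have cvy : c v = c y := bicolored_alternate bp vp xp yp cvx cxy.
(* The ends [x] and [v] of the opened cycle are adjacent and differ in color, so the path between
   them has an odd number of steps, namely [size q + 2]. *)
have oddq : odd (size q).
  have := bicolored_last bp (conflict_free_path cf sub pp).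
  by rewrite /= last_rcons (negPf cvx) size_rcons /=; case: (odd _).
apply/allpairsPdep; exists (y :: rcons q v), x; split => //.
  apply: mem_walks => /=; last 1 first.
  - by move: up => /= /andP[].
  - by rewrite size_rcons -{1}(odd_double_half (size q)) oddq.
  - by rewrite last_rcons.
  - by case/andP: pp.
rewrite /closing_step /=.
have -> : y != v.
  by move: up => /= /and3P[_ + _]; rewrite mem_rcons inE negb_or => /andP[].
have -> : ~~ conf y v.
  by apply/negP => /(cf _ _ (inT _ yp) (inT _ vp)); rewrite cvy eqxx.
by rewrite mem_enum !inE vx adj_sym xy.
Qed.

(** The first two vertices already show both colors; alternation forces the rest. *)
Lemma eq_bicolored_path c e x y r : bicolored c (x :: y :: r) ->
  bicolored e (x :: y :: r) ->
  path (fun y z => c y != c z) x (y :: r) ->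
  path (fun y z => e y != e z) x (y :: r) ->
  c x = e x -> c y = e y -> {in r, c =1 e}.
Proof.
elim: r x y => // z r IH x y bc be /= /and3P[cxy cyz cr] /and3P[exy eyz er] cx cy.
have cz : c z = e z.
  rewrite -(bicolored_alternate bc _ _ _ cxy cyz) ?inE ?eqxx ?orbT //.
  by rewrite -(bicolored_alternate be _ _ _ exy eyz) ?inE ?eqxx ?orbT.
have sub f : bicolored f [:: x, y, z & r] -> bicolored f [:: y, z & r].
  move=> /bicoloredP[i [j H]]; apply/bicoloredP; exists i, j => u ur.
  by apply: H; rewrite inE ur orbT.
move=> u; rewrite inE => /orP[/eqP -> //|ur].
by apply: (IH y z) ur => //=; [exact: sub|exact: sub|rewrite cyz|rewrite eyz].
Qed.

(** * Extending the colorings of [S] to one more vertex [v] *)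

Section Extension.
Variables (S : {set G}) (v : G).
Hypothesis vS : v \notin S.
Implicit Type u : {ffun G -> 'I_K} * 'I_K.

Definition extend u := recolor u.1 v u.2.

Definition clash u := [exists x in S, conf v x && (u.1 x == u.2)].

Definition bad p := [set u in setX (good S) setT | [&& ~~ clash u, uniq p,
  sorted (@adj G) p, all (mem (v |: S)) p & bicolored (extend u) p]].

Lemma in_pairs u : (u \in setX (good S) setT) = (u.1 \in good S).
Proof. by case: u => c a; rewrite in_setX in_setT andbT. Qed.

Lemma extend_in_S u : {in S, extend u =1 u.1}.
Proof.
by move=> x xS; rewrite ffunE; case: eqP xS vS => // -> ->.
Qed.

Lemma extend_v u : extend u v = u.2.
Proof. by rewrite ffunE eqxx. Qed.

(** Outside [S] both colorings take the junk value [o], so nothing is lost. *)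
Lemma extend_inj u u' : u.1 \in good S -> u'.1 \in good S ->
  {in v |: S, extend u =1 extend u'} -> u = u'.
Proof.
case: u u' => [c a] [c' a'] /=; rewrite !inE.
move=> /asboolP[co _ _] /asboolP[co' _ _] E.
have := E v (setU11 _ _); rewrite !extend_v /= => ->; congr (_, _).
apply/ffunP => x; have [xS|xS] := boolP (x \in S); last by rewrite co ?co'.
by have := E x (setU1r _ xS); rewrite !extend_in_S.
Qed.

Lemma extend_conflict_free u : u.1 \in good S -> ~~ clash u ->
  conflict_free (v |: S) (extend u).
Proof.
rewrite inE => /asboolP[_ cf _] ncl.
have vx x : x \in S -> conf v x -> u.2 != u.1 x.
  move=> xS vx; apply: contraNneq ncl => E; apply/existsP; exists x.
  by rewrite xS vx E eqxx.
move=> x y /setU1P[->|xS] /setU1P[->|yS]; rewrite ?extend_v ?extend_in_S //.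
- by rewrite conf_irr.
- exact: vx.
- by rewrite conf_sym eq_sym; apply: vx.
- exact: cf.
Qed.

(** Restriction to [S] minus [r] is injective on [bad]: as [v] lies in [r], the vertices [x] and [y]
    survive, and their colors determine those of all of [r], including the color chosen for [v]. *)
Lemma card_bad x y (r : seq G) : v \in r ->
  #|bad (x :: y :: r)| <= #|good (S :\: [set z in r])|.
Proof.
move=> vr; set S' := S :\: _.
have S'S : S' \subset S by rewrite subsetDl.
rewrite -(@card_in_imset _ _ (fun u => restrict S' u.1)) => [|u u'].
  apply/subset_leq_card/subsetP => _ /imsetP[u + ->].
  by rewrite in_set in_pairs => /andP[gu _]; apply: good_restrict gu.
rewrite in_set in_pairs => /andP[gu /and5P[clu up sp ap bu]].
rewrite in_set in_pairs => /andP[gu' /and5P[clu' _ _ _ bu']] E.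
have sub : {subset x :: y :: r <= v |: S} by apply/allP.
have xS' : x \in S'.
  move: up; rewrite /= inE negb_or => /and3P[/andP[_ xr] _ _].
  have := sub x (mem_head _ _); rewrite !inE xr; case: eqP => // xv.
  by rewrite xv vr in xr.
have yS' : y \in S'.
  move: up => /= /and3P[_ yr _].
  have : y \in v |: S by apply: sub; rewrite !inE eqxx orbT.
  rewrite !inE yr; case: eqP => // yv.
  by rewrite yv vr in yr.
have EE z : z \in S' -> extend u z = extend u' z.
  move=> zS'; have zS := subsetP S'S _ zS'.
  have /ffunP/(_ z) := E; rewrite ![restrict _ _ _]ffunE zS' => Ez.
  by rewrite !extend_in_S.
apply: extend_inj => // z zS.
have [zr|zr] := boolP (z \in r).
  move: zr; apply: (eq_bicolored_path bu bu'); rewrite ?EE //.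
    exact: conflict_free_path (extend_conflict_free gu clu) _ sp.
  exact: conflict_free_path (extend_conflict_free gu' clu') _ sp.
apply: EE; rewrite inE inE zr /=; case/setU1P: zS => // zv.
by rewrite zv vr in zr.
Qed.

Lemma card_good_extend : #|[set u in setX (good S) setT |
  extend u \in good (v |: S)]| <= #|good (v |: S)|.
Proof.
rewrite -(@card_in_imset _ _ extend) => [|u u'].
  apply/subset_leq_card/subsetP => _ /imsetP[u + ->].
  by rewrite inE => /andP[].
rewrite in_set in_pairs => /andP[gu _].
rewrite in_set in_pairs => /andP[gu' _] E.
by apply: extend_inj => // z _; rewrite E.
Qed.

(** A clashing pair is determined by the coloring and a conflicting vertex [x], whose color is the
    one given to [v]. *)
Lemma card_clash : #|[set u in setX (good S) setT | clash u]| <= L * #|good S|.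
Proof.
pose f (c : {ffun G -> 'I_K}) x := (c, c x).
apply: (@leq_trans #|f @2: (good S, [set x | conf v x])|).
  apply/subset_leq_card/subsetP => -[c a]; rewrite in_set in_pairs.
  case/andP=> gc /existsP[x /and3P[xS vx /eqP /= cx]].
  by apply/imset2P; exists c x; [|rewrite in_set|rewrite /f cx].
rewrite curry_imset2X; apply: leq_trans (leq_imset_card _ _) _.
by rewrite cardsX mulnC leq_mul2r conf_le orbT.
Qed.

(* Both orientations of a bicolored cycle through v are counted; this is where
   the factor 1/2 of the bound comes from. *)
Lemma unextendable_bad u : u.1 \in good S -> ~~ clash u ->
  extend u \notin good (v |: S) ->
  1 < \sum_(m < #|G|) count (fun p => u \in bad p) (closed_walks v m).
Proof.
move=> gu clu; have cf := extend_conflict_free gu clu.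
move=> ngu; have : ~ acyclic_on (v |: S) (extend u).
  move=> ac; move: ngu; rewrite inE => /asboolPn; apply; split=> //.
  move=> x; rewrite !inE negb_or => /andP[xv xS]; rewrite ffunE (negPf xv).
  by move: gu; rewrite inE => /asboolP[-> ].
move=> /existsNP[p /not_implyP[pS /not_implyP[sp /not_implyP[up]]]].
move=> /not_implyP[cp /negP]; rewrite negbK => bp.
have vp : v \in p.
  (* A cycle avoiding [v] would already be bicolored in the good coloring of [S]. *)
  apply: contraT => vp; move: gu; rewrite inE => /asboolP[_ _ ac].
  have pS' : {subset p <= S}.
    move=> x xp; have /setU1P[xv|//] := pS x xp.
    by rewrite -xv xp in vp.
  have := ac p pS' sp up cp; rewrite -(@eq_bicolored (extend u)) ?bp //.
  by move=> x /pS' xS; rewrite extend_in_S.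
have [i q rp] := rot_to vp.
have memq : rcons q v =i p.
  by move=> x; rewrite mem_rcons -rp mem_rot.
have sq : size p = (size q).+1 by rewrite -(size_rot i) rp.
have uq : uniq (rcons q v) by rewrite rcons_uniq -cons_uniq -rp rot_uniq.
have cq : cycle (@adj G) (rcons q v) by rewrite -rot1_cons rot_cycle -rp rot_cycle.
have memq' : rcons (rev q) v =i p.
  by move=> x; rewrite -memq !mem_rcons !inE mem_rev.
have uq' : uniq (rcons (rev q) v).
  by rewrite rcons_uniq mem_rev rev_uniq -rcons_uniq.
have cq' : cycle (@adj G) (rcons (rev q) v).
  rewrite -rev_cons rev_cycle -rp rot_cycle.
  by rewrite (@eq_cycle _ _ (@adj G)) // => x y; rewrite adj_sym.
(* With at least three vertices on the cycle, [q] has two distinct ends, so reversing it changes the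
   list. *)
have neq : rcons q v != rcons (rev q) v.
  rewrite eqseq_rcons eqxx andbT; case: (q) sq uq sp => [|x r] -> //= uq sp.
  rewrite rev_cons; case/lastP: r uq sp => [|r z] //= uq sp.
  rewrite rev_rcons; apply/eqP => -[xz _]; move: uq.
  by rewrite xz !mem_rcons inE mem_rcons mem_head orbT.
have badq r : rcons r v =i p -> uniq (rcons r v) -> cycle (@adj G) (rcons r v) ->
    u \in bad (rcons r v).
  move=> mr ur cr; rewrite in_set in_pairs gu clu ur /=.
  rewrite (eq_mem_bicolored _ mr) bp andbT; apply/andP; split.
    case: r cr {mr ur} => //= x r; rewrite rcons_path => /andP[] //.
  by apply/allP => x; rewrite mr => /pS.
have inq r : rcons r v =i p -> size r = size q -> uniq (rcons r v) ->
    cycle (@adj G) (rcons r v) -> rcons r v \in closed_walks v (size q)./2.-1.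
  move=> mr sr ur cr; rewrite -sr; apply: (mem_closed_walks cf) => //.
  - by move=> x; rewrite mr => /pS.
  - by rewrite sr -ltnS -sq.
  - by rewrite (eq_mem_bicolored _ mr).
(* A cycle has at most [#|G|] vertices, which justifies truncating the sum over [m]. *)
have lt_m : (size q)./2.-1 < #|G|.
  have : size p <= #|G| by rewrite -(card_uniqP up) max_card.
  rewrite sq; apply: leq_ltn_trans; apply: leq_trans (leq_pred _) _.
  by rewrite -{2}(odd_double_half (size q)) -addnn addnA leq_addl.
rewrite (bigD1 (Ordinal lt_m)) //=; apply: ltn_addr.
set W := closed_walks _ _ in inq *.
have /perm_to_rem pw := inq _ memq erefl uq cq.
have := inq _ memq' (size_rev q) uq' cq'.
rewrite (perm_mem pw) inE eq_sym (negPf neq) => /perm_to_rem pw'.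
rewrite (permP pw) /= badq //; rewrite (permP pw') /= badq //.
Qed.

(** Each pair extends well, clashes, or is counted at least twice among the bad pairs. Doubling
    keeps the factor 1/2 within the natural numbers. *)
Lemma card_good_setU1 : (K * #|good S|).*2 <=
  (#|good (v |: S)| + L * #|good S|).*2 +
  \sum_(m < #|G|) \sum_(p <- closed_walks v m) #|bad p|.
Proof.
set P := setX (good S) [set: 'I_K].
set A := [set u in P | extend u \in good (v |: S)].
set B := [set u in P | clash u].
set C := P :\: (A :|: B).
have cP : #|P| <= #|A| + #|B| + #|C|.
  rewrite -[#|P|](cardsID (A :|: B)) leq_add2r.
  apply: leq_trans (leq_card_setU A B).
  by apply: subset_leq_card; rewrite subsetIr.
have cC : #|C|.*2 <= \sum_(m < #|G|) \sum_(p <- closed_walks v m) #|bad p|.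
  have -> : \sum_(m < #|G|) \sum_(p <- closed_walks v m) #|bad p| =
     \sum_u \sum_(m < #|G|) count (fun p => u \in bad p) (closed_walks v m).
    rewrite [RHS]exchange_big /=; apply: eq_bigr => m _.
    under [RHS]eq_bigr do rewrite -sum1_count big_mkcond /=.
    rewrite [RHS]exchange_big /=; apply: eq_bigr => p _.
    by rewrite -sum1_card big_mkcond.
  rewrite -muln2 -sum_nat_const big_mkcond; apply: leq_sum => u _.
  case: ifP => // uC; apply: unextendable_bad.
  - by move: uC; rewrite in_setD in_pairs => /andP[_].
  - apply: contraTN uC => clu; rewrite in_setD in_setU [u \in B]in_set clu.
    by case: (u \in P); rewrite ?orbT ?andbF.
  - apply: contraTN uC => gu; rewrite in_setD in_setU [u \in A]in_set gu.
    by case: (u \in P); rewrite ?andbF.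
have KP : K * #|good S| = #|P| by rewrite cardsX cardsT card_ord mulnC.
rewrite KP; apply: leq_trans (leq_add (leqnn _) cC).
rewrite -doubleD leq_double; apply: leq_trans cP _; rewrite leq_add2r.
exact: leq_add card_good_extend card_clash.
Qed.

End Extension.

(** * The inductive lower bound on the number of good colorings *)

Section Growth.
Local Open Scope ring_scope.
Variables (R : realFieldType) (beta : R).
Hypothesis beta_gt0 : 0 < beta.

(** The vertices of [B :\: A] are added one at a time, each contributing a factor [beta]. Growth is
    assumed only below size [n], so that the lemma can serve inside the induction proving growth. *)
Lemma growth_subset n (A B : {set G}) :
  (forall S v, (#|S| < n)%N -> v \notin S ->
     beta * #|good S|%:R <= #|good (v |: S)|%:R) ->
  A \subset B -> (#|B| <= n)%N ->
  #|good A|%:R * beta ^+ #|B :\: A| <= #|good B|%:R :> R.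
Proof.
move=> growth; have [k] := ubnP #|B|.
elim: k B => // k IH B Bk AB Bn; move: (AB).
rewrite subEproper => /predU1P[->|/properP[_ [v vB vA]]].
  by rewrite setDv cards0 expr0 mulr1.
have cB := cardsD1 v B; rewrite vB add1n in cB.
have cBA : #|B :\: A| = #|(B :\ v) :\: A|.+1.
  rewrite (cardsD1 v (B :\: A)) inE vA vB add1n.
  by rewrite !setDDl setUC.
have le_v : #|good A|%:R * beta ^+ #|(B :\ v) :\: A| <= #|good (B :\ v)|%:R :> R.
  have Bv : (#|B :\ v| < #|B|)%N by rewrite cB.
  apply: IH; [exact: leq_trans Bv _|by rewrite subsetD1 AB vA|].
  exact: leq_trans (ltnW Bv) Bn.
have := growth (B :\ v) v; rewrite setD1K // setD11 -cB => /(_ Bn isT).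
by apply: le_trans; rewrite cBA exprSr mulrA mulrC ler_pM2l.
Qed.

(** Past its first two vertices [p] has [2m+2] vertices, one of which is [v]; so [card_bad] deletes
    [2m+1] vertices from [S]. *)
Lemma card_bad_le n S v m p : v \notin S -> (#|S| <= n)%N ->
  (forall S v, (#|S| < n)%N -> v \notin S ->
     beta * #|good S|%:R <= #|good (v |: S)|%:R) ->
  p \in closed_walks v m ->
  #|bad S v p|%:R <= #|good S|%:R / beta ^+ m.*2.+1 :> R.
Proof.
move=> vS Sn growth /allpairsPdep[w [x [/walks_shape[sw lw] _ ->]]].
rewrite ler_pdivlMr ?exprn_gt0 //.
case: w sw lw => [|y r] //= [sr] lr.
have vr : v \in r by case: r sr lr => // z r _ /= <-; rewrite mem_last.
(* A bad pair, if there is one, certifies that [p] is duplicate-free and lies in [v |: S], as the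
   count of deleted vertices requires. *)
have [->|[u]] := set_0Vmem (bad S v [:: x, y & r]).
  by rewrite cards0 mul0r.
rewrite in_set in_pairs => /andP[_ /and5P[_ up _ /allP ap _]].
set r' := [set z in r].
have cr' : #|r'| = m.*2.+2.
  rewrite -sr cardsE; apply/card_uniqP.
  by move: up => /= /and3P[].
have csr : #|S :\: (S :\: r')| = m.*2.+1.
  have -> : S :\: (S :\: r') = r' :\ v.
    apply/setP => z; rewrite setDDr setDv set0U !in_set in_set1.
    have [->|zv] := eqVneq z v; first by rewrite (negPf vS).
    rewrite andbC /=; case zr: (z \in r) => //=.
    have : z \in v |: S by apply: ap; rewrite !inE zr !orbT.
    by rewrite !inE (negPf zv).
  by have := cardsD1 v r'; rewrite inE vr cr' add1n => -[].
rewrite -csr; apply: le_trans (growth_subset growth (subsetDl S r') Sn).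
by apply: ler_wpM2r; [rewrite exprn_ge0 ?ltW | rewrite ler_nat card_bad].
Qed.

Hypothesis beta_le : L%:R + beta
  + t%:R / 2 * D%:R * \sum_(m < #|G|) (D.-1%:R / beta) ^+ m.*2.+1 <= K%:R.

(** Strong induction on the size: the smaller cases bound the bad pairs through [card_bad_le], and
    [beta_le] says that [K] colors pay for clashes, bad pairs and a surplus [beta]. *)
Lemma growth n S v : #|S| = n -> v \notin S ->
  beta * #|good S|%:R <= #|good (v |: S)|%:R :> R.
Proof.
elim/ltn_ind: n S v => n IH S v Sn vS.
have {}IH T x : (#|T| < n)%N -> x \notin T ->
  beta * #|good T|%:R <= #|good (x |: T)|%:R by move=> Tn; exact: (IH _ Tn).
have sum_le : (\sum_(m < #|G|) \sum_(p <- closed_walks v m) #|bad S v p|)%:R <=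
    t%:R * D%:R * (\sum_(m < #|G|) (D.-1%:R / beta) ^+ m.*2.+1) * #|good S|%:R :> R.
  rewrite natr_sum mulr_sumr mulr_suml; apply: ler_sum => m _.
  apply: (@le_trans _ _ ((size (closed_walks v m))%:R *
      (#|good S|%:R / beta ^+ m.*2.+1))).
    rewrite natr_sum big_seq -sum1_size natr_sum mulr_suml [leRHS]big_seq.
    apply: ler_sum => p pm; rewrite mul1r.
    by apply: (@card_bad_le n) => //; rewrite Sn.
  rewrite expr_div_n !mulrA [leRHS]mulrAC; apply: ler_wpM2r.
    by rewrite invr_ge0 exprn_ge0 ?ltW.
  apply: ler_wpM2r => //; rewrite -natrX -!natrM ler_nat -mulnA mulnC.
  exact: size_closed_walks.
have := card_good_setU1 vS; rewrite -(ler_nat R) natrD -!muln2 !natrM natrD natrM.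
move: beta_le sum_le; set X := \sum_(m < _) _ ^+ _; set Y := (\sum_(m < _) _)%:R.
have : 0 <= #|good S|%:R :> R by [].
move: (#|good S|%:R : R) (#|good _|%:R : R) => N N' N0 hK hY h.
have := ler_wpM2r N0 hK; rewrite !mulrDl; lra.
Qed.

(** Starting from the single coloring of the empty set, growth gives at least [beta ^+ #|G|], a
    positive number of good colorings. *)
Lemma colorable_of_conflict_bounds : acyclic_colorable G K.
Proof.
suff : (0 < #|good setT|)%N.
  by rewrite card_gt0 => /set0Pn[c cT]; exists c; exact: good_acyclic_coloring.
have := @growth_subset #|G| set0 setT _ (sub0set _).
rewrite cardsT good_set0 mul1r setD0.
move=> /(_ (fun S v _ => @growth _ S v erefl) (leqnn _)) h; rewrite -(ltr_nat R); apply: lt_le_trans h.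
by rewrite exprn_gt0.
Qed.

End Growth.

End Colorings.
End Counting.

(** * The conflict relation given by a codegree threshold *)

Lemma nbr_le_max_degree (G : sgraph) (x : G) : (#|nbr x| <= max_degree G)%N.
Proof. exact: (leq_bigmax x). Qed.

(** Paths of length two from [x] are regrouped by their middle vertex. *)
Lemma sum_codegree_le (G : sgraph) (x : G) :
  (\sum_(y | y != x) #|nbr x :&: nbr y| <= max_degree G * (max_degree G).-1)%N.
Proof.
have -> : (\sum_(y | y != x) #|nbr x :&: nbr y| =
           \sum_(z in nbr x) #|nbr z :\ x|)%N.
  under eq_bigr do rewrite -sum1_card (big_mkcond (fun z => z \in _)) /=.
  rewrite exchange_big [RHS]big_mkcond /=; apply: eq_bigr => z _.
  case: (boolP (z \in nbr x)) => xz.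
    rewrite -sum1_card -big_mkcondr; apply: eq_bigl => y.
    by rewrite !inE in xz *; rewrite xz (adj_sym y).
  by rewrite big1 // => y _; rewrite in_setI (negPf xz).
apply: (@leq_trans (\sum_(z in nbr x) (max_degree G).-1)%N).
  apply: leq_sum => z; rewrite inE => xz.
  have := nbr_le_max_degree z; rewrite (cardsD1 x (nbr z)) inE adj_sym xz.
  by case: (max_degree G).
by rewrite sum_nat_const leq_mul2r nbr_le_max_degree orbT.
Qed.

Section Threshold.
Variables (R : realType) (G : sgraph) (s : R).
Hypothesis s_gt0 : 0 < s.
Let D := max_degree G.

Definition many_common (x y : G) := (x != y) && (s < #|nbr x :&: nbr y|%:R).

Lemma card_many_common_le x :
  #|[set y | many_common x y]|%:R <= D%:R * D.-1%:R / s :> R.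
Proof.
rewrite ler_pdivlMr //.
have /(le_trans _) : (\sum_(y | y != x) #|nbr x :&: nbr y|)%:R <=
    D%:R * D.-1%:R :> R by rewrite -natrM ler_nat sum_codegree_le.
apply; rewrite -sum1_card !natr_sum mulr_suml big_mkcond [leRHS]big_mkcond /=.
apply: ler_sum => y _; rewrite inE /many_common eq_sym.
by case: eqVneq => //= _; case: ltP => // /ltW; rewrite mul1r.
Qed.

(** Codegrees and conflict counts are integers, so both real bounds may be truncated; this only
    weakens the demand on [K]. *)
Lemma colorable_of_threshold (beta : R) (K : nat) : 0 < beta ->
  D%:R + D%:R * D.-1%:R / s + beta
    + s / 2 * D%:R * \sum_(m < #|G|) (D.-1%:R / beta) ^+ m.*2.+1 <= K%:R ->
  acyclic_colorable G K.
Proof.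
move=> beta_gt0 le_K; set X := \sum_(m < _) _ in le_K.
have X_ge0 : 0 <= X by apply: sumr_ge0 => m _; rewrite exprn_ge0 // divr_ge0 // ltW.
have L_ge0 : 0 <= D%:R * D.-1%:R / s by rewrite divr_ge0 ?mulr_ge0 // ltW.
(* The junk color [Ordinal K_gt0] needs a nonempty palette. *)
have K_gt0 : (0 < K)%N.
  rewrite -(ltr_nat R); apply: lt_le_trans le_K.
  have : 0 <= s / 2 * D%:R * X by rewrite !mulr_ge0 ?invr_ge0 // ltW.
  have : 0 <= D%:R :> R by [].
  lra.
pose conf (x y : G) := adj x y || many_common x y.
apply: (@colorable_of_conflict_bounds G conf D (D + Num.truncn (D%:R * D.-1%:R / s))
          (Num.truncn s) _ _ _ _ _ _ K (Ordinal K_gt0) R beta) => //.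
- by move=> x y; rewrite /conf /many_common adj_sym eq_sym setIC.
- by move=> x; rewrite /conf /many_common adj_irrefl eqxx.
- by move=> x y; rewrite /conf => ->.
- exact: nbr_le_max_degree.
- move=> x; have -> : [set y | conf x y] = nbr x :|: [set y | many_common x y].
    by apply/setP => y; rewrite !inE.
  apply: leq_trans (leq_card_setU _ _) (leq_add (nbr_le_max_degree x) _).
  by rewrite truncn_ge_nat // card_many_common_le.
- move=> x y xy; rewrite /conf /many_common xy /= negb_or -leNgt => /andP[_].
  by rewrite truncn_ge_nat // ltW.
- apply: le_trans le_K; rewrite -/X natrD.
  have : (Num.truncn (D%:R * D.-1%:R / s))%:R <= D%:R * D.-1%:R / s.
    by rewrite truncn_le.
  have : (Num.truncn s)%:R / 2 * D%:R * X <= s / 2 * D%:R * X.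
    by rewrite !ler_wpM2r // ?invr_ge0 // truncn_le ltW.
  lra.
Qed.

End Threshold.

(** * Numerical estimates and the choice of parameters *)

Lemma sum_odd_powers_le (R : realFieldType) (q : R) n : 0 <= q < 1 ->
  \sum_(m < n) q ^+ m.*2.+1 <= q / (1 - q ^+ 2).
Proof.
move=> /andP[q0 q1].
have q2 : 0 < 1 - q ^+ 2 by rewrite subr_gt0 expr_lt1.
rewrite ler_pdivlMr //.
have -> : (\sum_(m < n) q ^+ m.*2.+1) * (1 - q ^+ 2) = q * (1 - (q ^+ 2) ^+ n).
  elim: n => [|n IH]; first by rewrite big_ord0 expr0; ring.
  rewrite big_ord_recr mulrDl IH /= (exprS q n.*2) -mul2n exprM (exprS (q ^+ 2) n).
  ring.
by rewrite ler_piMr // gerBl exprn_ge0 // exprn_ge0.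
Qed.

(* The unit of slack absorbs the rounding of the bound down to an integer. *)
Lemma cycle_slack (R : realFieldType) (g D : R) :
  0 < g -> 3 <= g ^+ 2 -> 2 <= D -> let q := (D - 1) / (g * D) in
  g ^+ 2 / 3 * D * (q / (1 - q ^+ 2)) + 1 <= g * D / 2.
Proof.
move=> g_gt0 g2 D2; have D0 : 0 < D by lra.
(* A rational lower bound for the square root of 3. *)
have g17 : 17 / 10 <= g.
  rewrite leNgt; apply/negP => h; have := mulr_gt0 g_gt0 (_ : 0 < 17 / 10 - g).
  by rewrite subr_gt0 h => /(_ isT); move: g2; rewrite expr2; lra.
have E0 : 0 < g ^+ 2 * D ^+ 2 - (D - 1) ^+ 2 by nra.
have gD : g * D != 0 by rewrite mulf_neq0 ?gt_eqF.
rewrite /=; set q := (D - 1) / (g * D).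
have -> : g ^+ 2 / 3 * D * (q / (1 - q ^+ 2)) =
    g ^+ 3 * D ^+ 2 * (D - 1) / (3 * (g ^+ 2 * D ^+ 2 - (D - 1) ^+ 2)).
  have -> : 1 - q ^+ 2 = (g ^+ 2 * D ^+ 2 - (D - 1) ^+ 2) / (g * D) ^+ 2.
    by rewrite /q; field; rewrite ?lt0r_neq0 //.
  by rewrite /q; field; rewrite exprMn ?lt0r_neq0 //.
rewrite -lerBrDr ler_pdivrMr ?mulr_gt0 //.
set u := g ^+ 2 in g2 E0 *.
have -> : g ^+ 3 = g * u by rewrite /u; ring.
have D2' : 2 * D <= D ^+ 2 by rewrite expr2 ler_wpM2r // ltW.
have D3' : 2 * D ^+ 2 <= D ^+ 3.
  by rewrite [leRHS]exprS; apply: ler_wpM2r; rewrite ?sqr_ge0.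
(* The cleared inequality increases in [g], by [uP], and then in [u]. Putting [g = 17 / 10] and
   [u = 3] cancels the cubic terms and leaves a quadratic in [D], positive for [D >= 2]. *)
have uP : 0 <= (u - 3) * (D ^+ 3 + 2 * D ^+ 2) by apply: mulr_ge0; lra.
have gP : 0 <= (g - 17 / 10) *
    (u * (D ^+ 3 + 2 * D ^+ 2) - 3 * D * (D - 1) ^+ 2) by apply: mulr_ge0; lra.
have uD : 0 <= (u - 3) * (17 * D ^+ 3 + 34 * D ^+ 2 - 60 * D ^+ 2).
  by apply: mulr_ge0; lra.
have := sqr_ge0 (D - 2); lra.
Qed.

Lemma acyclic_chromatic_number_le (G : sgraph) k :
  acyclic_colorable G k -> (acyclic_chromatic_number G <= k)%N.
Proof.
by rewrite /acyclic_chromatic_number; case: ex_minnP => m _ H /asboolP/H.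
Qed.

(** The cube root [d] of the degree replaces real exponents by integer ones. Here [beta] is [g * D],
    and [g ^+ 2 = 3 / 2 * s] turns the cycle term into the left side of [cycle_slack]. *)
Lemma acyclic_chromatic_number_cube_root_bound (R : realType) (G : sgraph)
    (kappa d : R) :
  0 < d -> d ^+ 3 = (max_degree G)%:R -> (0 < max_degree G)%N ->
  2 <= kappa * d ^+ 2 ->
  (acyclic_chromatic_number G)%:R <=
    (1 / kappa + 3 / 2 * Num.sqrt (3 * kappa / 2)) * d ^+ 4 + d ^+ 3 - d / kappa.
Proof.
move=> d0 dD D1 kd; set b := Num.sqrt _; set B := (X in _ <= X).
have k0 : 0 < kappa by rewrite -(pmulr_lgt0 _ (exprn_gt0 2 d0)); lra.
have b2 : b ^+ 2 = 3 * kappa / 2 by rewrite sqr_sqrtr //; lra.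
have b0 : 0 < b by rewrite sqrtr_gt0; lra.
pose s : R := kappa * d ^+ 2; pose g : R := b * d.
have s0 : 0 < s by rewrite /s mulr_gt0 ?exprn_gt0.
have g0 : 0 < g by rewrite /g mulr_gt0.
have g2s : g ^+ 2 = 3 / 2 * s by rewrite /g exprMn b2 /s; field.
have g2 : 3 <= g ^+ 2 by rewrite g2s /s; lra.
set D := max_degree G in dD D1.
have D1E : D.-1%:R = D%:R - 1 :> R by rewrite -subn1 natrB.
(* Of the last term, [g * D] is spent on [beta] and the remaining half on bicolored cycles and
   rounding. *)
have BE : B = D%:R + D%:R * D.-1%:R / s + 3 / 2 * (g * D%:R).
  rewrite /B D1E -dD /g /s; field; rewrite ?gt_eqF //.
clearbody B g s; have B0 : 0 <= B.
  have h1 : 0 <= D%:R * D.-1%:R / s by rewrite divr_ge0 ?mulr_ge0 // ltW.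
  have h2 : 0 <= g * D%:R by rewrite mulr_ge0 // ltW.
  have h3 : 0 <= D%:R :> R by [].
  by rewrite BE; lra.
have BK : B < (Num.truncn B)%:R + 1 by rewrite natr1 truncnS_gt.
apply: le_trans (_ : (Num.truncn B)%:R <= _); last by rewrite truncn_le.
rewrite ler_nat; apply: acyclic_chromatic_number_le.
have [D2|D2] := leqP 2 D.
  apply: (@colorable_of_threshold R G s s0 (g * D%:R)).
    by rewrite mulr_gt0 // ltr0n.
  have D2R : 2 <= D%:R :> R by rewrite ler_nat.
  have := cycle_slack g0 g2 D2R; rewrite /= -D1E -/D.
  set q := D.-1%:R / (g * D%:R).
  have q01 : 0 <= q < 1.
    rewrite /q divr_ge0 ?mulr_ge0 ?(ltW g0) //=.
    rewrite ltr_pdivrMr ?mulr_gt0 ?ltr0n // mul1r D1E.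
    have g1 : 1 < g.
      rewrite ltNge; apply/negP => g_le1.
      by have : g ^+ 2 <= 1; [rewrite exprn_ile1 // ltW|lra].
    have : 0 <= (g - 1) * D%:R by apply: mulr_ge0; lra.
    lra.
  have sD : 0 <= s / 2 * D%:R by rewrite mulr_ge0 // divr_ge0 // ltW.
  have := ler_wpM2l sD (sum_odd_powers_le #|G| q01).
  rewrite g2s; lra.
have DE : D = 1%N by apply/eqP; rewrite eqn_leq D1 -ltnS D2.
(* For [D = 1] the cycle sum vanishes, being made of odd powers of 0. With [beta = 1] it suffices
   that [K >= 2], which follows from [g ^+ 2 >= 3]. *)
apply: (@colorable_of_threshold R G s s0 1) => //.
rewrite -/D DE /= big1; last by move=> m _; rewrite mul0r expr0n.
move: BE BK; rewrite DE /=; nra.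
Qed.

Theorem theorem4 (R : realType) (Delta : nat) (Delta_gt0 : (0 < Delta)%N) :
  (forall kappa : R, 2 / Delta%:R `^ (2 / 3) <= kappa ->
     forall G : sgraph, max_degree G = Delta ->
       (acyclic_chromatic_number G)%:R <=
         (1 / kappa + 3 / 2 * Num.sqrt (3 * kappa / 2)) * Delta%:R `^ (4 / 3)
         + Delta%:R - Delta%:R `^ (1 / 3) / kappa)
  /\
  ((3 <= Delta)%N ->
     forall G : sgraph, max_degree G = Delta ->
       (acyclic_chromatic_number G)%:R
         <= 9 / 2 `^ (5 / 3) * Delta%:R `^ (4 / 3) + Delta%:R :> R
       /\ 9 / 2 `^ (5 / 3) * Delta%:R `^ (4 / 3) + Delta%:R
         < (283 / 10 ^+ 2 + 483 / 10 ^+ 5) * Delta%:R `^ (4 / 3) + Delta%:R :> R).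
Proof.
have third (a : R) n : 0 < a -> a `^ (n%:R / 3) = (a `^ (1 / 3)) ^+ n.
  by move=> a0; rewrite -powR_mulrn ?powR_ge0 // -powRrM; congr (_ `^ _); field.
have cube (a : R) : 0 < a -> (a `^ (1 / 3)) ^+ 3 = a.
  by move=> a0; rewrite -third // divff ?pnatr_eq0 // powRr1 // ltW.
have D0 : 0 < Delta%:R :> R by rewrite ltr0n.
set d := Delta%:R `^ (1 / 3); have d0 : 0 < d by rewrite powR_gt0.
have d3 : d ^+ 3 = Delta%:R by rewrite cube.
rewrite !third // -/d.
have bound kappa : 2 / d ^+ 2 <= kappa -> forall G : sgraph,
    max_degree G = Delta -> (acyclic_chromatic_number G)%:R <=
      (1 / kappa + 3 / 2 * Num.sqrt (3 * kappa / 2)) * d ^+ 4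
      + Delta%:R - d / kappa.
  move=> kd G GD; rewrite -d3.
  apply: acyclic_chromatic_number_cube_root_bound; rewrite ?GD //.
  by rewrite -ler_pdivrMr ?exprn_gt0.
split=> [//|D3 G GD].
set c := (2 : R) `^ (1 / 3).
have c0 : 0 < c by rewrite powR_gt0.
have c3 : c ^+ 3 = 2 by rewrite cube.
have c5 a : a / c ^+ 5 = a * c / 4.
  have -> : (4 : R) = c ^+ 6 by rewrite (exprM c 3 2) c3 -natrX.
  by field; rewrite ?gt_eqF.
split; last first.
  rewrite ltrD2r ltr_pM2r ?exprn_gt0 // c5.
  (* Since [9 / c ^+ 5 = 9 * c / 4], a decimal bound on [c] suffices; it is checked by cubing. *)
  have : c < 1 + 259 / 10 ^+ 3 + 923 / 10 ^+ 6; last by lra.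
  rewrite -(ltr_pXn2r (_ : (0 < 3)%N)) ?nnegrE ?ltW //; last by lra.
  by rewrite c3; lra.
have kd : 2 / d ^+ 2 <= c ^+ 5 / 3.
  rewrite ler_pdivrMr ?exprn_gt0 //.
  have -> : c ^+ 5 / 3 * d ^+ 2 = 2 / 3 * (c * d) ^+ 2 by rewrite -c3; ring.
  (* Cubed, this reads [27 <= (2 * Delta) ^+ 2], which holds from [Delta = 3] on. *)
  have cd : 3 <= (c * d) ^+ 2.
    rewrite -(ler_pXn2r (_ : (0 < 3)%N)) ?nnegrE ?sqr_ge0 //.
    have -> : ((c * d) ^+ 2) ^+ 3 = (c ^+ 3 * d ^+ 3) ^+ 2 by ring.
    rewrite c3 d3.
    have : 3 <= Delta%:R :> R by rewrite ler_nat.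
    nra.
  lra.
have := bound _ kd G GD.
have -> : 3 * (c ^+ 5 / 3) / 2 = c ^+ 2 by rewrite (exprD c 3 2) c3; field.
rewrite sqrtr_sqr gtr0_norm // => /le_trans; apply.
have -> : 1 / (c ^+ 5 / 3) = 3 / c ^+ 5 by field; rewrite gt_eqF.
(* The subtracted term is dropped, and [3 / c ^+ 5 + 3 / 2 * c = 9 / 4 * c = 9 / c ^+ 5]. *)
have : 0 <= d / (c ^+ 5 / 3) by rewrite !divr_ge0 ?exprn_ge0 // ltW.
rewrite !c5; lra.
Qed.
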